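(* Let $k\in\mathbb{N}^+$ and $\boldsymbol{C}=(c_0,c_1,\ldots,c_k)\in\{0,1\}^{k+1}$, and let $\boldsymbol{C}'=(1,\ldots,1)-\boldsymbol{C}$. For all $n\in\mathbb{N}^+$ and all integers $m\ge c_k-1$, $$O_{\boldsymbol{C}}(n+1,m+1)=n^k F_{n+1}(\boldsymbol{C})\,O_{\boldsymbol{C}}(n,m)+n^k F_{n+1}(\boldsymbol{C}')\,O_{\boldsymbol{C}}(n,m+1),$$ with boundary condition $$O_{\boldsymbol{C}}(n,m)=\begin{cases}0,& m=c_k-1\ \text{ or }\ m>c_k-1+n,\\ 1,& m=c_k,\ n=1.\end{cases}$$
   Context: Optimization set: let $U$ be a finite set of $d$-dimensional vectors and $\boldsymbol{R}=(R_1,\ldots,R_d)$ a vector of relations; write $(\boldsymbol{x},\boldsymbol{y})\in\boldsymbol{R}$ if $(x_i,y_i)\in R_i$ for all $i$. A subset $A\subseteq U$ is a majorization set of $U$ by $\boldsymbol{R}$ if for every $\boldsymbol{u}\in U$ there is $\boldsymbol{a}\in A$ with $(\boldsymbol{a},\boldsymbol{u})\in\boldsymbol{R}$ or $\boldsymbol{a}=\boldsymbol{u}$. An optimization set is a majorization set of minimum cardinality. $\boldsymbol{C}$ sequential optimization numbers: let $k,n\ge1$ and $\boldsymbol{C}=(c_0,\ldots,c_k)\in\{0,1\}^{k+1}$. Consider arrays $(a_{ij})_{1\le i\le n,\,1\le j\le k}$ such that for each $j$ the sequence $(a_{1j},\ldots,a_{nj})$ is a permutation of $\{1,\ldots,n\}$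 (there are $n!^k$ such arrays). For each $j$ let $b_{ij}=(i,a_{ij})$, $U_j=\{b_{1j},\ldots,b_{nj}\}$, and let $S_j$ be the optimization set of $U_j$ by $(<,<)$ (so $b_{ij}\in S_j$ iff $a_{ij}<a_{i'j}$ for all $i'<i$). For each $i$ let $l_i$ be the number of $j\in\{1,\ldots,k\}$ with $b_{ij}\in S_j$; the index $i$ is selected iff $c_{l_i}=1$. Then $O_{\boldsymbol{C}}(n,m)$ is the number of arrays for which exactly $m$ indices $i\in\{1,\ldots,n\}$ are selected (so it is $0$ if $m<0$). For $j\ge2$, $F_j(\boldsymbol{C})=\sum_{p=0}^k c_p\binom{k}{p}\frac{1}{(j-1)^p}$, and $F_j(\boldsymbol{C}')$ is defined by the same formula with $c_p$ replaced by $c'_p=1-c_p$. *)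

(* Defs.v *)
From mathcomp Require Import all_boot all_order all_fingroup all_algebra.

Set Implicit Arguments.
Unset Strict Implicit.
Unset Printing Implicit Defensive.

Section OptimizationSets.

Variables (d : nat) (T : finType).
Implicit Types (R : d.-tuple (rel T)) (U A : {set d.-tuple T}).

Definition vrel R : rel (d.-tuple T) :=
  fun x y => [forall i, tnth R i (tnth x i) (tnth y i)].

Definition majorization_set R U A : bool :=
  (A \subset U) &&
  [forall u in U, [exists a in A, vrel R a u || (a == u)]].

(* The minimum ranges over a nonempty family, since [U] is a majorization set
   of itself.  When [vrel R] is a strict order, as it is below, the minimizer
   is unique: it is the set of minimal elements of [U]. *)
Definition optimization_set R U : {set d.-tuple T} :=
  [arg min_(A < U | majorization_set R U A) #|A|].

End OptimizationSets.

Definition ord_ltn n : rel 'I_n := fun x y => x < y.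

(* An n x k array whose columns are permutations is given by its columns:
   the entry a_(i,j) is [a j i].  Indices and values are taken in {0, .., n-1}
   rather than {1, .., n}, which is immaterial as only their order is used. *)
Section SequentialOptimization.

Variables (k n : nat).
Implicit Types (a : {ffun 'I_k -> 'S_n}) (i : 'I_n) (j : 'I_k).

Definition point a i j : 2.-tuple 'I_n := [tuple i; a j i].

Definition column_points a j : {set 2.-tuple 'I_n} :=
  [set point a i j | i : 'I_n].

Definition column_opt a j : {set 2.-tuple 'I_n} :=
  optimization_set [tuple @ord_ltn n; @ord_ltn n] (column_points a j).

Definition opt_count a i : nat := #|[set j | point a i j \in column_opt a j]|.

(* [opt_count a i <= k], so [inord] is exact here. *)
Definition selected (C : k.+1.-tuple bool) a : {set 'I_n} :=
  [set i | tnth C (inord (opt_count a i))].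

End SequentialOptimization.

Definition seqopt_number k (C : k.+1.-tuple bool) (n : nat) (m : int) : nat :=
  #|[set a : {ffun 'I_k -> 'S_n} | Posz #|selected C a| == m]|.

Local Open Scope ring_scope.

(* Meaningful for [2 <= j]. *)
Definition Fcoef k (C : k.+1.-tuple bool) (j : nat) : rat :=
  \sum_(p < k.+1) (tnth C p)%:R * 'C(k, p)%:R * (1 / (j.-1)%:R ^+ p).

Definition Ccompl k (C : k.+1.-tuple bool) : k.+1.-tuple bool :=
  [tuple of map negb C].

(* Main.v *)
Require Import Defs.
From mathcomp Require Import all_boot all_order all_fingroup all_algebra.
From mathcomp Require Import zify.
Local Open Scope ring_scope.

Set Implicit Arguments.
Unset Strict Implicit.

(** An [n.+1] x [k] array is the same as an [n] x [k] array, giving the relative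
order of the first [n] rows, together with a last row [v]. Adding the last row
keeps the records (left-to-right minima) of the first [n] rows, and the new
entry of column [j] is a record iff [v j] is the least value. There are
['C(k, p) * n ^ (k - p)] rows [v] with exactly [p] least entries. *)

(** * Optimization sets as sets of minimal elements *)

Definition minimal_elements (d : nat) (T : finType) (R : d.-tuple (rel T))
    (U : {set d.-tuple T}) : {set d.-tuple T} :=
  [set u in U | [forall v in U, ~~ vrel R v u]].

(** Descent in a finite set: among the elements of [U] equal to or below [u], one with the fewest
    elements below it is minimal, since anything below it would have strictly fewer. *)
Lemma minimal_elements_majorization (d : nat) (T : finType)
    (R : d.-tuple (rel T)) (U : {set d.-tuple T}) :
  irreflexive (vrel R) -> transitive (vrel R) ->
  majorization_set R U (minimal_elements R U).
Proof.
move=> Rirr Rtr; apply/andP; split.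
  by apply/subsetP => u; rewrite inE => /andP[].
apply/forall_inP => u uU.
have u0 : (u \in U) && (vrel R u u || (u == u)) by rewrite uU eqxx orbT.
pose below v := #|[set w in U | vrel R w v]|.
case: (@arg_minnP _ u (fun v => (v \in U) && (vrel R v u || (v == u))) below u0).
move=> v /andP[vU vu] vmin.
apply/exists_inP; exists v => //; rewrite inE vU /=.
apply/forall_inP => w wU; apply/negP => wv.
have wu : vrel R w u.
  by case/orP: vu => [vu|/eqP <-] //; apply: Rtr wv vu.
have := vmin w; rewrite wU wu => /(_ isT); apply/negP; rewrite -ltnNge.
apply: proper_card; apply/properP; split.
  apply/subsetP => x; rewrite !inE => /andP[-> xw] /=; exact: Rtr xw wv.
by exists w; rewrite inE wU //= Rirr.
Qed.

(** A minimal element can be majorized only by itself, so it lies in every majorization set; minimum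
    cardinality then forces equality. *)
Lemma optimization_setE (d : nat) (T : finType)
    (R : d.-tuple (rel T)) (U : {set d.-tuple T}) :
  irreflexive (vrel R) -> transitive (vrel R) ->
  optimization_set R U = minimal_elements R U.
Proof.
move=> Rirr Rtr.
have UU : majorization_set R U U.
  rewrite /majorization_set subxx; apply/forall_inP => u uU.
  by apply/exists_inP; exists u => //; rewrite eqxx orbT.
rewrite /optimization_set.
case: arg_minnP => // A /andP[AU /forall_inP Amaj] Amin.
apply/esym/eqP; rewrite eqEcard Amin ?minimal_elements_majorization // andbT.
apply/subsetP => u; rewrite inE => /andP[uU /forall_inP umin].
have /exists_inP[a aA /orP[au|/eqP <- //]] := Amaj u uU.
by have := umin a (subsetP AU a aA); rewrite au.
Qed.

Lemma vrel_ltnE (n : nat) (x y : 2.-tuple 'I_n) :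
  vrel [tuple @ord_ltn n; @ord_ltn n] x y =
  (tnth x ord0 < tnth y ord0)%N && (tnth x ord_max < tnth y ord_max)%N.
Proof.
apply/forallP/andP => [h|[h0 h1] i].
  by split; [have := h ord0 | have := h ord_max].
(* The default element inside [tnth] depends on the index, hence [set_nth_default]. *)
by case: i => [[|[|//]]] hi; rewrite /tnth /= /ord_ltn;
  [move: h0 | move: h1]; rewrite /tnth /=; congr (_ < _)%N;
  congr (nat_of_ord _); apply: set_nth_default; rewrite size_tuple.
Qed.

(** * Records of permutations *)

Definition is_record (n : nat) (s : 'S_n) (i : 'I_n) : bool :=
  [forall i' : 'I_n, (i' < i)%N ==> (s i < s i')%N].

Lemma mem_column_opt (k n : nat) (a : {ffun 'I_k -> 'S_n}) (i : 'I_n)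
    (j : 'I_k) :
  (point a i j \in column_opt a j) = is_record (a j) i.
Proof.
rewrite /column_opt optimization_setE; last first.
- move=> y x z; rewrite !vrel_ltnE => /andP[h1 h2] /andP[h3 h4].
  by rewrite (ltn_trans h1 h3) (ltn_trans h2 h4).
- by move=> x; rewrite vrel_ltnE ltnn.
have pointP i' : vrel [tuple @ord_ltn n; @ord_ltn n] (point a i' j) (point a i j)
    = (i' < i)%N && (a j i' < a j i)%N by rewrite vrel_ltnE.
have ptU i' : point a i' j \in column_points a j by apply: imset_f.
rewrite inE ptU /=; apply/forall_inP/forallP => [h i'|h v /imsetP[i' _ ->]].
  apply/implyP => lt_i'i; have := h _ (ptU i').
  rewrite pointP lt_i'i /= -leqNgt leq_eqVlt => /orP[|//].
  (* Equal entries would lie in the same row, so the weak inequality is strict. *)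
  by move/eqP/val_inj/perm_inj => e; rewrite e ltnn in lt_i'i.
rewrite pointP; apply/negP => /andP[lt_i'i]; apply/negP; rewrite -leqNgt ltnW //.
exact: implyP (h i') lt_i'i.
Qed.

Lemma opt_countE (k n : nat) (a : {ffun 'I_k -> 'S_n}) (i : 'I_n) :
  opt_count a i = #|[set j | is_record (a j) i]|.
Proof. by apply: eq_card => j; rewrite !inE mem_column_opt. Qed.

Lemma is_record_ord_max (n : nat) (s : 'S_n.+1) :
  is_record s ord_max = (s ord_max == ord0).
Proof.
apply/forallP/eqP => [h|si0 i].
  (* The row holding the least value cannot precede the last row, so it is the last row. *)
  have := h (s^-1 ord0)%g; rewrite permKV ltn0 implybF -leqNgt => le_n.
  have -> : ord_max = (s^-1 ord0)%g.
    by apply: val_inj; apply/eqP; rewrite eqn_leq le_n /= -ltnS.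
  by rewrite permKV.
apply/implyP; apply: contraTT; rewrite si0 -leqNgt leqn0 => /eqP si'0.
have -> : i = ord_max; last by rewrite ltnn.
by apply: (@perm_inj _ s); rewrite si0; apply: val_inj.
Qed.

Lemma ltn_lift (n : nat) (h : 'I_n.+1) (i j : 'I_n) :
  (lift h i < lift h j)%N = (i < j)%N.
Proof. by rewrite !ltnNge /= leq_bump2. Qed.

(** Records depend only on earlier rows and on relative order; [lift] is increasing on rows and on
    values, and the new row precedes no old one. *)
Lemma is_record_lift_perm (n : nat) (v : 'I_n.+1) (s : 'S_n) (i : 'I_n) :
  is_record (lift_perm ord_max v s) (lift ord_max i) = is_record s i.
Proof.
apply/forallP/forallP => h i'.
  by have := h (lift ord_max i'); rewrite !lift_perm_lift !ltn_lift.
case: (unliftP ord_max i') => [i'' ->|->].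
  by rewrite !lift_perm_lift !ltn_lift.
by rewrite lift_max /= ltnNge ltnW.
Qed.

(** * Appending a last row *)

Definition add_row (k n : nat)
    (va : {ffun 'I_k -> 'I_n.+1} * {ffun 'I_k -> 'S_n}) :
    {ffun 'I_k -> 'S_n.+1} :=
  [ffun j => lift_perm ord_max (va.1 j) (va.2 j)].

(** The last row recovers [v], then injectivity of [lift] recovers [a]; the cardinalities agree
    because (n+1)! = (n+1) n!. *)
Lemma add_row_bij (k n : nat) : bijective (@add_row k n).
Proof.
apply: inj_card_bij => [[v a] [v' a'] /ffunP e|].
  have ev : v = v'.
    apply/ffunP => j; have := e j; rewrite !ffunE /= => /permP/(_ ord_max).
    by rewrite !lift_perm_id.
  subst v'; congr (_, _); apply/ffunP => j; apply/permP => i.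
  have := e j; rewrite !ffunE /= => /permP/(_ (lift ord_max i)).
  by rewrite !lift_perm_lift => /lift_inj.
by rewrite card_prod !card_ffun !card_ord !card_Sn factS expnMn.
Qed.

Definition zeros (k n : nat) (v : {ffun 'I_k -> 'I_n.+1}) : {set 'I_k} :=
  [set j | v j == ord0].

Lemma card_selected_add_row (k n : nat) (C : k.+1.-tuple bool)
    (v : {ffun 'I_k -> 'I_n.+1}) (a : {ffun 'I_k -> 'S_n}) :
  #|selected C (add_row (v, a))| =
  (#|selected C a| + tnth C (inord #|zeros v|))%N.
Proof.
have cardE m (P : pred 'I_m) : #|[set i | P i]| = (\sum_(i < m) P i)%N.
  by rewrite -sum1dep_card big_mkcond; apply: eq_bigr => i _; case: (P i).
rewrite !cardE big_ord_recr /=; congr (_ + _)%N.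
  apply: eq_bigr => i _; congr (nat_of_bool (tnth C (inord _))).
  rewrite !opt_countE; apply: eq_card => j; rewrite !inE ffunE.
  (* [big_ord_recr] reaches the old rows through [widen_ord], which has the same value as
     [lift ord_max]. *)
  rewrite -(is_record_lift_perm (v j) (a j)); congr is_record; apply: val_inj.
  by rewrite [RHS]lift_max.
congr (nat_of_bool (tnth C (inord _))).
rewrite opt_countE cardE; apply: eq_bigr => j _; rewrite ffunE.
by rewrite is_record_ord_max lift_perm_id.
Qed.

(** * Counting last rows by their zeros *)

Lemma card_zeros_fiber (k n : nat) (Z : {set 'I_k}) :
  #|[set v : {ffun 'I_k -> 'I_n.+1} | zeros v == Z]| = (n ^ (k - #|Z|))%N.
Proof.
(* With the zero set fixed, a column in [Z] has one choice and any other has the n nonzero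
   values. *)
pose F j : pred 'I_n.+1 := if j \in Z then pred1 ord0 else predC1 ord0.
transitivity #|(family F : simpl_pred {ffun 'I_k -> 'I_n.+1})|.
  apply: eq_card => v; rewrite inE; apply/eqP/familyP => [e j|h].
    by rewrite /F -e !inE; case: ifP => [/eqP -> //|/negbT]; rewrite ?inE.
  apply/setP => j; have := h j; rewrite /F !inE.
  by case: ifP => _; rewrite inE // => /negbTE.
rewrite card_family foldrE big_map big_enum /= (bigID (mem Z)) /=.
rewrite big1 ?mul1n => [|j jZ]; last by rewrite /F jZ card1.
rewrite (eq_bigr (fun=> n)) => [|j /negbTE jZ]; last first.
  by rewrite /F jZ cardC1 card_ord.
rewrite prod_nat_const; congr (_ ^ _)%N.
by rewrite -[X in (X - _)%N]card_ord -(cardC (mem Z)) addKn.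
Qed.

Lemma card_rows (k n p : nat) :
  #|[set v : {ffun 'I_k -> 'I_n.+1} | #|zeros v| == p]| =
  ('C(k, p) * n ^ (k - p))%N.
Proof.
rewrite -sum1dep_card.
rewrite (partition_big (@zeros k n) (fun Z => #|Z| == p)) //=.
rewrite (eq_bigr (fun=> n ^ (k - p)))%N => [|Z /eqP Zp].
  by rewrite sum_nat_cond_const card_draws card_ord.
rewrite -Zp -card_zeros_fiber -sum1dep_card; apply: eq_bigl => v.
by case: (zeros v =P Z) => [->|]; rewrite ?eqxx ?andbF.
Qed.

Lemma card_rows_selected (k n : nat) (C : k.+1.-tuple bool) : (0 < n)%N ->
  #|[set v : {ffun 'I_k -> 'I_n.+1} | tnth C (inord #|zeros v|)]|%:R =
  n%:R ^+ k * Fcoef C n.+1 :> rat.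
Proof.
move=> n0; have nz : n%:R != 0 :> rat by rewrite Num.Theory.pnatr_eq0 -lt0n.
have le_k (v : {ffun 'I_k -> 'I_n.+1}) : (#|zeros v| < k.+1)%N.
  by rewrite ltnS -[leqRHS](card_ord k) max_card.
rewrite -sum1dep_card.
rewrite (partition_big (fun v => inord #|zeros v| : 'I_k.+1) (tnth C)) //=.
rewrite GRing.natr_sum /Fcoef GRing.mulr_sumr big_mkcond /=.
apply: eq_bigr => p _; case: ifP => Cp; last by rewrite !GRing.mul0r GRing.mulr0.
transitivity (#|[set v : {ffun 'I_k -> 'I_n.+1} | #|zeros v| == p]|%:R : rat).
  rewrite -sum1dep_card; congr (_%:R); apply: eq_bigl => v.
  (* By [le_k] the number of zeros is at most k, so [inord] does not fall back to its default. *)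
  rewrite -(inj_eq val_inj) /= inordK //.
  case: eqP => // e; last by rewrite andbF.
  by rewrite e inord_val Cp.
(* This turns the count of rows with p zeros into n^k times the term of index p in [Fcoef], whose
   denominator is n^p at j = n+1. *)
have powE : n%:R ^+ (k - p) = n%:R ^+ k / n%:R ^+ p :> rat.
  by apply: GRing.expfB_cond; rewrite (negbTE nz) add0n -ltnS.
rewrite card_rows GRing.natrM GRing.natrX powE GRing.div1r /= GRing.mul1r.
by rewrite GRing.mulrCA.
Qed.

(** * Recurrence and boundary values *)

Lemma seqopt_number_rec (k n : nat) (C : k.+1.-tuple bool) (m : int) :
  seqopt_number C n.+1 (m + 1) =
  (#|[set v : {ffun 'I_k -> 'I_n.+1} | tnth C (inord #|zeros v|)]|
     * seqopt_number C n m
   + #|[set v : {ffun 'I_k -> 'I_n.+1} | tnth (Ccompl C) (inord #|zeros v|)]|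
     * seqopt_number C n (m + 1))%N.
Proof.
pose sel b : {set {ffun 'I_k -> 'I_n.+1}} :=
  [set v | tnth C (inord #|zeros v|) == b].
pose arr c : {set {ffun 'I_k -> 'S_n}} := [set a | Posz #|selected C a| == c].
(* A selected last row must extend an array with m selected rows, an unselected one an array with
   m+1. *)
have -> : seqopt_number C n.+1 (m + 1) =
    #|setX (sel true) (arr m) :|: setX (sel false) (arr (m + 1))|.
  rewrite /seqopt_number -(on_card_preimset (f := @add_row k n)); last first.
    by apply: onW_bij; apply: add_row_bij.
  apply: eq_card => [[v a]]; rewrite !inE /= card_selected_add_row PoszD.
  case: (tnth C _) => /=; last by rewrite GRing.addr0.
  by rewrite orbF (inj_eq (GRing.addIr _)).
rewrite cardsU [X in (_ - X)%N](_ : _ = 0%N).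
  rewrite subn0 !cardsX; congr (_ * _ + _ * _)%N; apply: eq_card => v.
    by rewrite !inE eqb_id.
  by rewrite !inE /Ccompl tnth_map eqbF_neg.
by apply: eq_card0 => [[v a]]; rewrite !inE /=; case: (tnth C _); rewrite ?andbF.
Qed.

(** No row precedes the first, so it is a record in all k columns. *)
Lemma selected_ord0 (k n : nat) (C : k.+1.-tuple bool)
    (a : {ffun 'I_k -> 'S_n.+1}) :
  (ord0 \in selected C a) = tnth C ord_max.
Proof.
rewrite inE opt_countE; congr (tnth C _); apply: val_inj => /=.
rewrite (_ : [set j | _] = setT) ?cardsT ?card_ord ?inordK //.
by apply/setP => j; rewrite !inE; apply/forallP => i'.
Qed.

(** The first row contributes exactly c_k, and each of the n others at most 1. *)
Lemma card_selected_bounds (k n : nat) (C : k.+1.-tuple bool)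
    (a : {ffun 'I_k -> 'S_n.+1}) :
  (tnth C ord_max <= #|selected C a| <= tnth C ord_max + n)%N.
Proof.
rewrite (cardsD1 ord0) selected_ord0 leq_addr leq_add2l /=.
rewrite -ltnS -[leqRHS](card_ord n.+1) -cardsT (cardsD1 ord0 setT) inE.
by rewrite ltnS subset_leq_card // setSD // subsetT.
Qed.

Unset Implicit Arguments.
Set Strict Implicit.

Theorem theorem2p2 (k : nat) (hk : (0 < k)%N) (C : k.+1.-tuple bool) :
  let ck : int := Posz (tnth C ord_max) in
  [/\ forall (n : nat) (m : int), (0 < n)%N -> ck - 1 <= m ->
        (seqopt_number C n.+1 (m + 1))%:R =
          n%:R ^+ k * Fcoef C n.+1 * (seqopt_number C n m)%:R
          + n%:R ^+ k * Fcoef (Ccompl C) n.+1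
              * (seqopt_number C n (m + 1))%:R :> rat,
      forall (n : nat) (m : int), (0 < n)%N ->
        m = ck - 1 \/ ck - 1 + Posz n < m -> seqopt_number C n m = 0%N
    & forall (n : nat) (m : int), m = ck -> n = 1%N ->
        seqopt_number C n m = 1%N].
Proof.
move=> ck; split=> [n m n0 _|[//|n] m _ hm|n m -> ->].
- by rewrite seqopt_number_rec GRing.natrD !GRing.natrM !card_rows_selected.
(* With n+1 rows the count lies between c_k and c_k + n, and both cases of [hm] fall outside this
   range. *)
- apply/eqP; rewrite cards_eq0; apply/eqP/setP => a; rewrite !inE.
  apply/negbTE/eqP => e; have := card_selected_bounds C a.
  move: hm; rewrite -e /ck; lia.
(* For one row the two bounds coincide, so the only array qualifies. *)
- rewrite /seqopt_number (_ : [set _ | _] = setT).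
    by rewrite cardsT card_ffun card_Sn exp1n.
  apply/setP => a; rewrite !inE /ck; have := card_selected_bounds C a.
  by rewrite addn0 -eqn_leq => /eqP e; apply/eqP; congr Posz.
Qed.
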